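(* Let $p,q>0$ be real numbers and let $(\mathcal{S}_n)$ be the generalized Padovan sequence with parameters $p,q$, i.e. $\mathcal{S}_{-2}=0$, $\mathcal{S}_{-1}=0$, $\mathcal{S}_0=1$ and $\mathcal{S}_{n+1}=p\,\mathcal{S}_{n-1}+q\,\mathcal{S}_{n-2}$ for all integers $n\ge 0$. Let $$F_1=\bigcup_{n=-1}^{\infty}\Big\{(x_{-1},x_0,y_{-1},y_0)\in\mathbb{R}^4:\ \mathcal{S}_n x_{-1}+\mathcal{S}_{n-1}y_0x_{-1}+q\,\mathcal{S}_{n-2}=0\Big\},$$ $$F_2=\bigcup_{n=-1}^{\infty}\Big\{(x_{-1},x_0,y_{-1},y_0)\in\mathbb{R}^4:\ \mathcal{S}_n y_{-1}+\mathcal{S}_{n-1}x_0y_{-1}+q\,\mathcal{S}_{n-2}=0\Big\}.$$ Let $(x_n,y_n)_{n\ge -1}$ be a solution of the system $$x_{n+1}=\frac{p\,x_{n-1}+q}{y_nx_{n-1}},\qquad y_{n+1}=\frac{p\,y_{n-1}+q}{x_ny_{n-1}},\qquad n=0,1,2,\ldots,$$ with initial conditions $(x_{-1},x_0,y_{-1},y_0)\in\mathbb{R}^4\setminus(F_1\cup F_2)$. Then, for $n=1,2,\ldots$, $$x_n=\begin{cases}\dfrac{\mathcal{S}_{n+1}y_{-1}+\mathcal{S}_n x_0y_{-1}+q\,\mathcal{S}_{n-1}}{\mathcal{S}_n y_{-1}+\mathcal{S}_{n-1}x_0y_{-1}+q\,\mathcal{S}_{n-2}}, & n \text{ even},\\[1.2em]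 \dfrac{\mathcal{S}_{n+1}x_{-1}+\mathcal{S}_n y_0x_{-1}+q\,\mathcal{S}_{n-1}}{\mathcal{S}_n x_{-1}+\mathcal{S}_{n-1}y_0x_{-1}+q\,\mathcal{S}_{n-2}}, & n \text{ odd},\end{cases}$$ $$y_n=\begin{cases}\dfrac{\mathcal{S}_{n+1}x_{-1}+\mathcal{S}_n y_0x_{-1}+q\,\mathcal{S}_{n-1}}{\mathcal{S}_n x_{-1}+\mathcal{S}_{n-1}y_0x_{-1}+q\,\mathcal{S}_{n-2}}, & n \text{ even},\\[1.2em] \dfrac{\mathcal{S}_{n+1}y_{-1}+\mathcal{S}_n x_0y_{-1}+q\,\mathcal{S}_{n-1}}{\mathcal{S}_n y_{-1}+\mathcal{S}_{n-1}x_0y_{-1}+q\,\mathcal{S}_{n-2}}, & n \text{ odd}.\end{cases}$$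
   Context: The system is the rewriting, with $p=\alpha/\gamma$ and $q=\beta/\gamma$, of $x_{n+1}=\frac{\alpha x_{n-1}+\beta}{\gamma y_nx_{n-1}}$, $y_{n+1}=\frac{\alpha y_{n-1}+\beta}{\gamma x_ny_{n-1}}$ with $\alpha,\beta,\gamma>0$. The sets $F_1,F_2$ are called the forbidden sets of the system. The value $\mathcal{S}_{-3}$ occurring in the $n=-1$ terms of $F_1,F_2$ is obtained by extending the recurrence backwards one step: $\mathcal{S}_0=p\,\mathcal{S}_{-2}+q\,\mathcal{S}_{-3}$, i.e. $\mathcal{S}_{-3}=1/q$. *)

(* Defs.v *)
From mathcomp Require Import all_boot all_order all_algebra.
From mathcomp Require Import classical_sets reals.

Set Implicit Arguments.
Unset Strict Implicit.
Unset Printing Implicit Defensive.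

Import Order.TTheory GRing.Theory Num.Theory.
Local Open Scope classical_set_scope.
Local Open Scope ring_scope.

(* The sequence is indexed by [int]; its values below index -3 are left
   unconstrained and are never used.  The last clause is the recurrence run one
   step backwards: it fixes S (-3) = 1 / q. *)
Definition gen_padovan (R : realType) (p q : R) (S : int -> R) : Prop :=
  [/\ S (-2) = 0, S (-1) = 0, S 0 = 1,
      forall n : nat, S (n%:Z + 1) = p * S (n%:Z - 1) + q * S (n%:Z - 2)
    & S 0 = p * S (-2) + q * S (-3)].

(* Quadruples are ordered as (x_{-1}, x_0, y_{-1}, y_0). *)
Definition F1 (R : realType) (q : R) (S : int -> R) : set (R * R * R * R) :=
  \bigcup_(n in [set n : int | -1 <= n])
    [set v | let: (xm1, x0, ym1, y0) := v in
       S n * xm1 + S (n - 1) * y0 * xm1 + q * S (n - 2) = 0].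

Definition F2 (R : realType) (q : R) (S : int -> R) : set (R * R * R * R) :=
  \bigcup_(n in [set n : int | -1 <= n])
    [set v | let: (xm1, x0, ym1, y0) := v in
       S n * ym1 + S (n - 1) * x0 * ym1 + q * S (n - 2) = 0].

(* Only the values at indices >= -1 matter.  Division is total, and no
   nonvanishing of the denominators is required here: off the forbidden sets
   it follows from the recurrence. *)
Definition solution (R : realType) (p q : R) (x y : int -> R) : Prop :=
  forall n : nat,
    x (n%:Z + 1) = (p * x (n%:Z - 1) + q) / (y n%:Z * x (n%:Z - 1)) /\
    y (n%:Z + 1) = (p * y (n%:Z - 1) + q) / (x n%:Z * y (n%:Z - 1)).

(* Main.v *)
(* The two subsequences x_{-1}, y_0, x_1, y_2, ... and y_{-1}, x_0, y_1, x_2, ...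
   are decoupled: each satisfies u_{n+1} = (p u_{n-1} + q) / (u_n u_{n-1}).
   Putting u_n = D_{n+1} / D_n linearizes this into the Padovan recurrence
   D_{n+2} = p D_n + q D_{n-1}, with D_{-1} = 1, D_0 = u_{-1} and
   D_1 = u_0 u_{-1}; the forbidden sets say exactly that no D_n vanishes. *)

Require Import Defs.
From mathcomp Require Import all_boot all_order all_algebra.
From mathcomp Require Import classical_sets reals.
From mathcomp Require Import ring zify.

Import Order.TTheory GRing.Theory Num.Theory.
Local Open Scope classical_set_scope.
Local Open Scope ring_scope.

(** This is $D_n$, with $a=u_{-1}$ and $b=u_0$. The factors are ordered as in [F1] and [F2], so that
    $D_n=0$ is by conversion the equation of their $n$-th piece. *)
Definition padovan_comb {R : realType} (q : R) (S : int -> R) (a b : R)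
    (n : int) : R :=
  S n * a + S (n - 1) * b * a + q * S (n - 2).

(** $D$ is a fixed linear combination of three shifts of $S$, each obeying the linear recurrence.
    For $n=0$ the shift by two reaches $S_{-3}$, which is where the backward clause enters. *)
Lemma padovan_comb_rec (R : realType) (p q : R) (S : int -> R) (a b : R)
    (n : nat) :
  gen_padovan p q S ->
  padovan_comb q S a b (n%:Z + 2) =
    p * padovan_comb q S a b n%:Z + q * padovan_comb q S a b (n%:Z - 1).
Proof.
case=> Sm2 Sm1 S0 Srec S0rec.
have Sn2 : S (n%:Z + 2) = p * S n%:Z + q * S (n%:Z - 1).
  have := Srec n.+1.
  have -> : n.+1%:Z + 1 = n%:Z + 2 by lia.
  have -> : n.+1%:Z - 1 = n%:Z by lia.
  by have -> : n.+1%:Z - 2 = n%:Z - 1 by lia.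
have Sn : S n%:Z = p * S (n%:Z - 2) + q * S (n%:Z - 3).
  case: n {Sn2} => [|n]; first exact: S0rec.
  have := Srec n.
  have -> : n%:Z + 1 = n.+1%:Z by lia.
  have -> : n%:Z - 1 = n.+1%:Z - 2 by lia.
  by have -> : n%:Z - 2 = n.+1%:Z - 3 by lia.
rewrite /padovan_comb.
have -> : n%:Z + 2 - 1 = n%:Z + 1 by lia.
have -> : n%:Z + 2 - 2 = n%:Z by lia.
have -> : n%:Z - 1 - 1 = n%:Z - 2 by lia.
have -> : n%:Z - 1 - 2 = n%:Z - 3 by lia.
(* Only the $S_n$ in the last term $q S_n$ of $D_{n+2}$ is expanded; the others match $p S_n a$ on
   the right. *)
by rewrite Sn2 Srec {2}Sn; ring.
Qed.

Lemma decoupled_closed_form (R : realType) (p q : R) (S u : int -> R) :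
  gen_padovan p q S ->
  (forall n : nat,
     u (n%:Z + 1) = (p * u (n%:Z - 1) + q) / (u n%:Z * u (n%:Z - 1))) ->
  (forall n : int, -1 <= n -> padovan_comb q S (u (-1)) (u 0) n != 0) ->
  forall n : nat,
    u n%:Z = padovan_comb q S (u (-1)) (u 0) (n%:Z + 1) /
             padovan_comb q S (u (-1)) (u 0) n%:Z.
Proof.
move=> hS urec; set D := padovan_comb q S _ _ => D_neq0.
have Drec n : D (n%:Z + 2) = p * D n%:Z + q * D (n%:Z - 1).
  exact: padovan_comb_rec.
case: (hS) => Sm2 Sm1 S0 Srec S0rec.
(* $D_{-1}$ collapses to $q S_{-3}$, which the backward clause equates with $S_0$. *)
have Dm1 : D (-1) = 1.
  by rewrite /D /padovan_comb Sm1 Sm2 -S0 S0rec Sm2; ring.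
have D0 : D 0 = u (-1) by rewrite /D /padovan_comb S0 Sm1 Sm2; ring.
have D1 : D 1 = u 0 * u (-1).
  have S1 : S 1 = 0 by rewrite (Srec 0%N) Sm1 Sm2; ring.
  by rewrite /D /padovan_comb S1 S0 Sm1; ring.
(* The recurrence for $u$ has order two, so the induction carries two consecutive indices, starting
   from $-1$ and $0$. *)
suff pair (n : nat) : u (n%:Z - 1) = D n%:Z / D (n%:Z - 1) /\
                      u n%:Z = D (n%:Z + 1) / D n%:Z.
  by move=> n; case: (pair n).
elim: n => [|n [IHp IHn]].
  split; first by rewrite Dm1 D0 divr1.
  by rewrite D1 D0 mulfK // -D0 D_neq0.
have -> : n.+1%:Z - 1 = n%:Z by lia.
have -> : n.+1%:Z = n%:Z + 1 by lia.
split=> //.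
have -> : n%:Z + 1 + 1 = n%:Z + 2 by lia.
have Dp : D (n%:Z - 1) != 0 by apply: D_neq0; lia.
have Dn : D n%:Z != 0 by apply: D_neq0; lia.
have Ds : D (n%:Z + 1) != 0 by apply: D_neq0; lia.
(* The product $u_n u_{n-1}$ telescopes to $D_{n+1}/D_{n-1}$, leaving $(p D_n + q
   D_{n-1})/D_{n+1}$. *)
by rewrite urec IHp IHn Drec; field; rewrite Dp Dn Ds.
Qed.

Theorem theorem5 (R : realType) (p q : R) (hp : 0 < p) (hq : 0 < q)
  (S : int -> R) (hS : gen_padovan p q S)
  (x y : int -> R) (hxy : solution p q x y)
  (hF : (~` (F1 q S `|` F2 q S)) (x (-1), x 0, y (-1), y 0)) :
  forall n : nat, (1 <= n)%N ->
    x n%:Z =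
      (if ~~ odd n then
         (S (n%:Z + 1) * y (-1) + S n%:Z * x 0 * y (-1) + q * S (n%:Z - 1)) /
         (S n%:Z * y (-1) + S (n%:Z - 1) * x 0 * y (-1) + q * S (n%:Z - 2))
       else
         (S (n%:Z + 1) * x (-1) + S n%:Z * y 0 * x (-1) + q * S (n%:Z - 1)) /
         (S n%:Z * x (-1) + S (n%:Z - 1) * y 0 * x (-1) + q * S (n%:Z - 2))) /\
    y n%:Z =
      (if ~~ odd n then
         (S (n%:Z + 1) * x (-1) + S n%:Z * y 0 * x (-1) + q * S (n%:Z - 1)) /
         (S n%:Z * x (-1) + S (n%:Z - 1) * y 0 * x (-1) + q * S (n%:Z - 2))
       else
         (S (n%:Z + 1) * y (-1) + S n%:Z * x 0 * y (-1) + q * S (n%:Z - 1)) /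
         (S n%:Z * y (-1) + S (n%:Z - 1) * x 0 * y (-1) + q * S (n%:Z - 2))).
Proof.
have hx (n : int) : -1 <= n -> padovan_comb q S (x (-1)) (y 0) n != 0.
  by move=> n_ge; apply/eqP => Dn0; apply: hF; left; exists n.
have hy (n : int) : -1 <= n -> padovan_comb q S (y (-1)) (x 0) n != 0.
  by move=> n_ge; apply/eqP => Dn0; apply: hF; right; exists n.
(* The absolute value makes $-1$ odd, so [alternate x y] starts with $x_{-1}, y_0$ by computation,
   as [hx] expects. *)
pose alternate (v w : int -> R) (z : int) := if odd `|z|%N then v z else w z.
have alternate_rec v w : solution p q v w -> forall n : nat,
    alternate v w (n%:Z + 1) = (p * alternate v w (n%:Z - 1) + q) /
                               (alternate v w n%:Z * alternate v w (n%:Z - 1)).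
  move=> vw n; rewrite /alternate.
  have -> : odd `|(n%:Z + 1)%R|%N = ~~ odd n by lia.
  have -> : odd `|(n%:Z - 1)%R|%N = ~~ odd n by lia.
  by rewrite absz_nat; case: (vw n) => vn wn; case: (odd n).
have hyx : solution p q y x by move=> n; case: (hxy n).
have Ex := decoupled_closed_form R p q S (alternate x y) hS (alternate_rec x y hxy) hx.
have Ey := decoupled_closed_form R p q S (alternate y x) hS (alternate_rec y x hyx) hy.
move=> n _; move: (Ex n) (Ey n).
rewrite /alternate /padovan_comb absz_nat /=.
have -> : n%:Z + 1 - 1 = n%:Z by lia.
have -> : n%:Z + 1 - 2 = n%:Z - 1 by lia.
(* For odd $n$, [Ex] gives $x_n$ and [Ey] gives $y_n$; for even $n$ they trade places. *)
by case: (odd n).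
Qed.
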